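(* Let $n\ge1$ and $k\ge4$ be integers. Then there exists an $(n+k)$-dimensional integral polytope $\mathcal{P}$ such that the coefficients of $t^{n+k-2},t^{n+k-3},\dots,t^{n+3}$ in $i(\mathcal{P},t)$ are positive and the coefficients of $t^{n+2},t^{n+1},\dots,t$ in $i(\mathcal{P},t)$ are negative.
   Context: An integral polytope is a convex polytope all of whose vertices have integer coordinates. For an integral polytope $\mathcal{P}\subseteq\mathbb{R}^N$ of dimension $d$, $i(\mathcal{P},t)=|t\mathcal{P}\cap\mathbb{Z}^N|$ ($t$ a positive integer) is a polynomial in $t$ of degree $d$, the Ehrhart polynomial. *)

(* Defs.v *)
From HB Require Import structures.
From mathcomp Require Import all_boot all_order all_algebra finmap.
From mathcomp Require Import all_classical reals.

Set Implicit Arguments.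
Unset Strict Implicit.
Unset Printing Implicit Defensive.

Import Order.TTheory GRing.Theory Num.Theory.
Local Open Scope classical_set_scope.
Local Open Scope ring_scope.

Section Polytopes.
Context {R : realType} {N : nat}.
Implicit Types (P : set 'rV[R]_N) (x : 'rV[R]_N).

Definition convex_hull (m : nat) (v : 'I_m -> 'rV[R]_N) : set 'rV[R]_N :=
  [set x | exists a : 'I_m -> R,
    [/\ forall i, 0 <= a i, \sum_i a i = 1 & x = \sum_i a i *: v i]].

Definition affine_hull P : set 'rV[R]_N :=
  [set x | exists (m : nat) (v : 'I_m -> 'rV[R]_N) (a : 'I_m -> R),
    [/\ forall i, P (v i), \sum_i a i = 1 & x = \sum_i a i *: v i]].

(* The affine hull is a translate of a linear subspace of dimension d; in
   particular P is nonempty. *)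
Definition has_dimension P (d : nat) : Prop :=
  exists (x0 : 'rV[R]_N) (U : {vspace 'rV[R]_N}),
    \dim U = d /\ affine_hull P = [set x | x - x0 \in U].

Definition convex_polytope P : Prop :=
  exists (m : nat) (v : 'I_m -> 'rV[R]_N), P = convex_hull v.

Definition vertex P x : Prop :=
  P x /\ forall (y z : 'rV[R]_N) (s : R), P y -> P z -> 0 < s < 1 ->
    x = s *: y + (1 - s) *: z -> y = x /\ z = x.

Definition integer_points : set 'rV[R]_N :=
  [set x | forall j, x ord0 j \is a Num.int].

Definition integral_polytope P : Prop :=
  convex_polytope P /\ vertex P `<=` integer_points.

Definition dilate (t : nat) P : set 'rV[R]_N := [set t%:R *: x | x in P].

(* [fset_set] of an infinite set is empty; this does not occur for polytopes,
   which are bounded. *)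
Definition lattice_count P (t : nat) : nat :=
  #|` fset_set (dilate t P `&` integer_points)|%fset.

(* Such a p is unique, as it is determined at infinitely many points. *)
Definition ehrhart_polynomial P (p : {poly R}) : Prop :=
  forall t : nat, (0 < t)%N -> p.[t%:R] = (lattice_count P t)%:R.

End Polytopes.

(* Main.v *)
Require Import Defs.
From mathcomp Require Import all_boot all_order all_algebra.
From mathcomp Require Import all_classical reals.
From mathcomp Require Import finmap zify ring lra.
Import Order.TTheory GRing.Theory Num.Theory.
Local Open Scope classical_set_scope.
Local Open Scope ring_scope.

(* Ehrhart polynomials multiply over products, so take a product of a dilated
   Reeve tetrahedron conv(0, e1, e2, (1, 1, 6M)), with Ehrhart polynomial
   (t + 1)^2 + M (t^3 - t), and segments [0, l], with Ehrhart polynomial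
   1 + l t. For M large only the part proportional to M matters, and after
   division by M s t it reads (s^2 t^2 - 1) (1 + t)^(k-3) prod_i (1 + l_i t).
   For s large, (s^2 t^2 - 1) (1 + t)^(k-3) is negative exactly in degrees 0
   and 1, and each factor 1 + l_i t with l_i large shifts the signs by one
   degree while keeping the constant term negative. *)

Set Implicit Arguments.
Unset Strict Implicit.

(** * Lattice polytopes of full dimension, their point counts and their dilates *)

Section HullFacts.
Context {R : realType} {N : nat}.
Implicit Types (P : set 'rV[R]_N) (p : {poly R}).

(** The last clause, affine spanning, forces the dimension to be that of the ambient space. It is
    stated on generators, which may include non-vertices, so that it passes to dilates and products
    without computing vertices or affine hulls. *)
Definition full_lattice_polytope P : Prop :=
  exists (m : nat) (v : 'I_m -> 'rV[R]_N),
    [/\ P = convex_hull v, forall i, integer_points (v i) &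
        forall x, exists a : 'I_m -> R,
          \sum_i a i = 1 /\ x = \sum_i a i *: v i].

(** The duplicate-free list certifies finiteness, so the default value of [fset_set] never
    intervenes, and the list for a product is obtained by pairing. *)
Definition lattice_counted P p : Prop :=
  forall t : nat, (0 < t)%N -> exists e : seq 'rV[R]_N,
    [/\ uniq e, forall x, (dilate t P `&` integer_points) x <-> x \in e &
        p.[t%:R] = (size e)%:R].

Lemma convex_hull_generator (m : nat) (v : 'I_m -> 'rV[R]_N) i :
  convex_hull v (v i).
Proof.
exists (fun j => (j == i)%:R); split=> [j||].
- exact: ler0n.
- by rewrite (bigD1 i) //= eqxx big1 ?addr0 // => j /negPf ->.
- rewrite (bigD1 i) //= eqxx scale1r big1 ?addr0 // => j /negPf ->.
  by rewrite scale0r.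
Qed.

(** Some weight [a i] is positive. If it is 1, all other weights vanish. Otherwise [x] lies strictly
    between [v i] and the renormalised combination of the remaining generators, and extremality
    gives [v i = x]. *)
Lemma vertex_convex_hull (m : nat) (v : 'I_m -> 'rV[R]_N) x :
  vertex (convex_hull v) x -> exists i, x = v i.
Proof.
move=> [[a [a_ge0 a_sum xE]] extr].
have [i ai_gt0] : exists i, 0 < a i.
  apply/existsP; rewrite -[X in is_true X]negbK negb_exists; apply/negP.
  move=> /forallP a_le0; suff : \sum_i a i = 0.
    by move/eqP; rewrite a_sum oner_eq0.
  apply: big1 => i _; apply/eqP; rewrite eq_le a_ge0 andbT leNgt; exact: a_le0.
have a_rest : \sum_(j | j != i) a j = 1 - a i.
  by apply/eqP; rewrite eq_sym subr_eq -a_sum addrC [eqbLHS](bigD1 i).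
have rest_ge0 : 0 <= 1 - a i by rewrite -a_rest sumr_ge0.
exists i; have [ai1|ai1] := eqVneq (a i) 1.
  rewrite xE (bigD1 i) //= ai1 scale1r big1 ?addr0 // => j ji.
  have := a_rest; rewrite ai1 subrr => /eqP.
  rewrite psumr_eq0 // => /allP /(_ j); rewrite mem_index_enum ji /= => /(_ isT).
  by move/eqP ->; rewrite scale0r.
have ai_lt1 : 0 < 1 - a i by rewrite lt_def rest_ge0 andbT subr_eq0 eq_sym.
pose b j := if j == i then 0 else a j / (1 - a i).
have hull_rest : convex_hull v (\sum_j b j *: v j).
  exists b; split=> //.
    by move=> j; rewrite /b; case: ifP => // _; rewrite divr_ge0.
  rewrite (bigD1 i) //= {1}/b eqxx add0r.
  rewrite (eq_bigr (fun j => a j / (1 - a i))); last first.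
    by move=> j /negPf ji; rewrite /b ji.
  by rewrite -mulr_suml a_rest divff // gt_eqF.
have [] // := extr _ _ (a i) (convex_hull_generator v i) hull_rest.
  by rewrite ai_gt0 /= -subr_gt0.
rewrite xE (bigD1 i) //=; congr (_ + _).
rewrite scaler_sumr [RHS](bigD1 i) //= /b eqxx scale0r scaler0 add0r.
apply: eq_bigr => j /negPf ->.
by rewrite scalerA mulrC divfK // gt_eqF.
Qed.

Lemma full_lattice_polytope_integral P :
  full_lattice_polytope P -> integral_polytope P.
Proof.
move=> [m [v [-> v_int _]]]; split; first by exists m, v.
by move=> x /vertex_convex_hull [i ->].
Qed.

Lemma full_lattice_polytope_dim P :
  full_lattice_polytope P -> has_dimension P N.
Proof.
move=> [m [v [-> _ span]]]; exists 0, fullv.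
split; first by rewrite dimvf dim_matrix mul1r.
apply/seteqP; split=> x _ /=; first by rewrite memvf.
have [a [a_sum xE]] := span x; exists m, v, a; split=> // i.
exact: convex_hull_generator.
Qed.

Lemma lattice_counted_ehrhart P p :
  lattice_counted P p -> ehrhart_polynomial P p.
Proof.
move=> cP t /cP [e [e_uniq eP ->]]; congr (_%:R); rewrite /lattice_count.
have -> : dilate t P `&` integer_points = [set` [fset x in e]%fset].
  by apply/seteqP; split=> x; rewrite /= inE => /eP.
by rewrite set_fsetK card_fseq undup_id.
Qed.

Lemma dilateM (s t : nat) P : dilate t (dilate s P) = dilate (t * s) P.
Proof.
apply/seteqP; split=> x /=.
  by move=> [_ [y Py <-] <-]; exists y => //; rewrite scalerA natrM.
move=> [y Py <-]; exists (s%:R *: y); first by exists y.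
by rewrite scalerA natrM.
Qed.

Lemma full_lattice_polytope_dilate (s : nat) P : (0 < s)%N ->
  full_lattice_polytope P -> full_lattice_polytope (dilate s P).
Proof.
move=> s_gt0 [m [v [-> v_int span]]]; exists m, (fun i => s%:R *: v i).
have s_neq0 : s%:R != 0 :> R by rewrite pnatr_eq0 -lt0n.
have scaleE a : \sum_i a i *: (s%:R *: v i) = s%:R *: \sum_i a i *: v i.
  by rewrite scaler_sumr; apply: eq_bigr => i _; rewrite !scalerA mulrC.
split.
- apply/seteqP; split=> x /=.
    by move=> [_ [a [a0 a1 ->]] <-]; exists a; rewrite scaleE.
  move=> [a [a0 a1 ->]]; exists (\sum_i a i *: v i); last by rewrite scaleE.
  by exists a.
- by move=> i j; rewrite mxE rpredM ?rpred_nat //; apply: v_int.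
- move=> x; have [a [a_sum aE]] := span (s%:R^-1 *: x).
  by exists a; rewrite scaleE -aE scalerA divff // scale1r.
Qed.

Lemma lattice_counted_dilate (s : nat) P p : (0 < s)%N ->
  lattice_counted P p -> lattice_counted (dilate s P) (p \Po (s%:R *: 'X)).
Proof.
move=> s_gt0 cP t t_gt0; rewrite dilateM horner_comp hornerZ hornerX.
by rewrite -natrM mulnC; apply: cP; rewrite muln_gt0 s_gt0.
Qed.

End HullFacts.

(** * Products of polytopes: counts multiply, integrality and spanning persist *)

Section Product.
Context {R : realType} {N1 N2 : nat}.
Implicit Types (P : set 'rV[R]_N1) (Q : set 'rV[R]_N2).

Definition polytope_prod P Q : set 'rV[R]_(N1 + N2) :=
  [set x | P (lsubmx x) /\ Q (rsubmx x)].

Lemma integer_points_prod :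
  @integer_points R (N1 + N2) = polytope_prod integer_points integer_points.
Proof.
apply/seteqP; split=> x /=.
  by move=> xi; split=> j; rewrite mxE; apply: xi.
move=> [xl xr] j; rewrite -(hsubmxK x) mxE.
by case: splitP => i _; [apply: xl | apply: xr].
Qed.

Lemma dilate_prod (t : nat) P Q :
  dilate t (polytope_prod P Q) = polytope_prod (dilate t P) (dilate t Q).
Proof.
apply/seteqP; split=> x /=.
  move=> [y [Py Qy] <-]; rewrite /polytope_prod /= !linearZ /=.
  by split; [exists (lsubmx y) | exists (rsubmx y)].
move=> [[y Py yE] [z Qz zE]]; exists (row_mx y z).
  by rewrite /polytope_prod /= row_mxKl row_mxKr.
by rewrite scale_row_mx yE zE hsubmxK.
Qed.

(** Dilation and integrality both act on the two blocks separately, so the lattice points are the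
    concatenations of lattice points of the factors. *)
Lemma lattice_counted_prod P Q p q :
  lattice_counted P p -> lattice_counted Q q ->
  lattice_counted (polytope_prod P Q) (p * q).
Proof.
move=> cP cQ t t_gt0.
have [e [e_uniq eP pE]] := cP t t_gt0; have [f [f_uniq fP qE]] := cQ t t_gt0.
exists [seq row_mx x y | x <- e, y <- f]; split.
- apply: allpairs_uniq => // -[x y] [x' y'] _ _ /= /eq_row_mx [-> ->] //.
- move=> x; rewrite integer_points_prod dilate_prod; split.
    move=> /= [[Px Qx] [xl xr]]; apply/allpairsP; exists (lsubmx x, rsubmx x).
    by rewrite hsubmxK; split=> //; [apply/eP | apply/fP].
  move=> /allpairsP [[y z] [/= /eP [Py yi] /fP [Qz zi] ->]].
  by rewrite /polytope_prod /= row_mxKl row_mxKr.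
- by rewrite hornerM pE qE size_allpairs natrM.
Qed.

(** The generators are the pairs of generators. Combinations with weights [a] and [b] combine
    through the product weights [a i * b j]; conversely, weights on pairs project to their two
    marginals. *)
Lemma full_lattice_polytope_prod P Q :
  full_lattice_polytope P -> full_lattice_polytope Q ->
  full_lattice_polytope (polytope_prod P Q).
Proof.
move=> [m [v [-> v_int v_span]]] [n [w [-> w_int w_span]]].
(* [convex_hull] takes families indexed by ordinals, so pairs are numbered through [enum_val]. *)
pose I : finType := ('I_m * 'I_n)%type.
pose u (k : 'I_#|I|) := row_mx (v (enum_val k).1) (w (enum_val k).2).
have sumE (V : zmodType) (F : I -> V) :
    \sum_(k < #|I|) F (enum_val k) = \sum_i \sum_j F (i, j).
  rewrite pair_big /= (reindex (@enum_val I predT)) /=; last first.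
    by apply: onW_bij; apply: enum_val_bij.
  by apply: eq_bigr => k _; case: (enum_val k).
(* Stated for weights of any sign, so that it serves the convex combinations of the hull as well as
   the affine ones of the spanning clause. *)
have comb (a : 'I_m -> R) (b : 'I_n -> R) : \sum_i a i = 1 -> \sum_j b j = 1 ->
    let c (k : 'I_#|I|) := a (enum_val k).1 * b (enum_val k).2 in
    \sum_k c k = 1 /\
    row_mx (\sum_i a i *: v i) (\sum_j b j *: w j) = \sum_k c k *: u k.
  move=> a1 b1 /=; split.
    rewrite (sumE _ (fun ij => a ij.1 * b ij.2)) /= -a1.
    by apply: eq_bigr => i _; rewrite -mulr_sumr b1 mulr1.
  rewrite -[RHS]hsubmxK !linear_sum /=; congr row_mx.
    rewrite (eq_bigr (fun k => (a (enum_val k).1 * b (enum_val k).2)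
                               *: v (enum_val k).1)); last first.
      by move=> k _; rewrite linearZ /= row_mxKl.
    rewrite (sumE _ (fun ij => (a ij.1 * b ij.2) *: v ij.1)) /=.
    by apply: eq_bigr => i _; rewrite -scaler_suml -mulr_sumr b1 mulr1.
  rewrite (eq_bigr (fun k => (a (enum_val k).1 * b (enum_val k).2)
                             *: w (enum_val k).2)); last first.
    by move=> k _; rewrite linearZ /= row_mxKr.
  rewrite (sumE _ (fun ij => (a ij.1 * b ij.2) *: w ij.2)) /= exchange_big /=.
  by apply: eq_bigr => j _; rewrite -scaler_suml -mulr_suml a1 mul1r.
exists #|I|, u; split.
- apply/seteqP; split=> x /=.
    move=> [[a [a0 a1 aE]] [b [b0 b1 bE]]].
    have [c1 cE] := comb a b a1 b1; eexists; split; [|exact: c1|].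
      by move=> k; rewrite mulr_ge0.
    by rewrite -cE -aE -bE hsubmxK.
  move=> [c [c0 c1 ->]]; rewrite /polytope_prod /= !linear_sum /=.
  pose C ij := c (enum_rank ij).
  have CE k : c k = C (enum_val k) by rewrite /C enum_valK.
  have C1 : \sum_i \sum_j C (i, j) = 1.
    by rewrite -(sumE _ C) -c1; apply: eq_bigr.
  split.
    exists (fun i => \sum_j C (i, j)); split=> [i||] //.
      by apply: sumr_ge0 => j _; apply: c0.
    rewrite (eq_bigr (fun k => C (enum_val k) *: v (enum_val k).1)); last first.
      by move=> k _; rewrite linearZ /= row_mxKl CE.
    rewrite (sumE _ (fun ij => C ij *: v ij.1)) /=.
    by apply: eq_bigr => i _; rewrite scaler_suml.
  exists (fun j => \sum_i C (i, j)); split=> [j||].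
  - by apply: sumr_ge0 => i _; apply: c0.
  - by rewrite exchange_big.
  rewrite (eq_bigr (fun k => C (enum_val k) *: w (enum_val k).2)); last first.
    by move=> k _; rewrite linearZ /= row_mxKr CE.
  rewrite (sumE _ (fun ij => C ij *: w ij.2)) /= exchange_big /=.
  by apply: eq_bigr => j _; rewrite scaler_suml.
- by move=> k; rewrite integer_points_prod /polytope_prod /= row_mxKl row_mxKr.
- move=> x; have [a [a1 aE]] := v_span (lsubmx x).
  have [b [b1 bE]] := w_span (rsubmx x).
  have [c1 cE] := comb a b a1 b1; eexists; split; first exact: c1.
  by rewrite -cE -aE -bE hsubmxK.
Qed.

End Product.

(** * The segments [0, l] and their lattice points *)

Section Segment.
Context {R : realType}.

Definition segment (l : nat) : set 'rV[R]_1 :=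
  convex_hull (fun i : 'I_2 => const_mx (i * l)%:R).

(** The generator of index 0 is the origin, so only the weight of the other one, [lift ord0 ord0],
    survives. *)
Lemma segment_comb (l : nat) (a : 'I_2 -> R) :
  \sum_i a i *: const_mx (i * l)%:R = const_mx (a (lift ord0 ord0) * l%:R)
    :> 'rV[R]_1.
Proof.
rewrite !big_ord_recl big_ord0 /=; apply/rowP => j.
by rewrite !mxE mul0n mulr0 add0r addr0 mul1n.
Qed.

Lemma segmentP (l : nat) (x : 'rV[R]_1) : (0 < l)%N ->
  segment l x <-> 0 <= x 0 0 <= l%:R.
Proof.
move=> l_gt0; have l_gt0' : 0 < l%:R :> R by rewrite ltr0n.
split.
  move=> [a [a_ge0 a_sum ->]]; rewrite segment_comb mxE mulr_ge0 //=.
  rewrite ler_piMl // -a_sum !big_ord_recl big_ord0 addr0 /=.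
  by rewrite lerDr a_ge0.
move=> /andP [x_ge0 x_le]; pose w := x 0 0 / l%:R.
exists (fun i => if val i == 0%N then 1 - w else w); split.
- case=> -[|i] i_lt /=; last by rewrite divr_ge0.
  by rewrite subr_ge0 ler_pdivrMr // mul1r.
- by rewrite !big_ord_recl big_ord0 /= addr0 subrK.
- rewrite segment_comb /= /w divfK ?gt_eqF //.
  by apply/rowP => j; rewrite mxE [j]ord1.
Qed.

Lemma segment_full (l : nat) : (0 < l)%N ->
  full_lattice_polytope (segment l).
Proof.
move=> l_gt0; exists 2%N, (fun i : 'I_2 => const_mx (i * l)%:R); split=> //.
  by move=> i j; rewrite mxE rpred_nat.
move=> x; pose w := x 0 0 / l%:R.
exists (fun i => if val i == 0%N then 1 - w else w); split.
  by rewrite !big_ord_recl big_ord0 /= addr0 subrK.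
rewrite segment_comb /= /w divfK ?pnatr_eq0 -?lt0n //.
by apply/rowP => j; rewrite mxE [j]ord1.
Qed.

Lemma segment_dilateP (l t : nat) (x : 'rV[R]_1) : (0 < l)%N -> (0 < t)%N ->
  dilate t (segment l) x <-> 0 <= x 0 0 <= (t * l)%:R.
Proof.
move=> l_gt0 t_gt0; have t_gt0' : 0 < t%:R :> R by rewrite ltr0n.
split.
  move=> [y /(segmentP _ l_gt0) /andP [y0 yl] <-].
  by rewrite mxE mulr_ge0 //= natrM ler_wpM2l.
move=> /andP [x0 xl]; exists (t%:R^-1 *: x); last first.
  by rewrite scalerA divff ?gt_eqF // scale1r.
apply/(segmentP _ l_gt0); rewrite mxE mulr_ge0 ?invr_ge0 //=.
by rewrite mulrC ler_pdivrMr // -natrM mulnC.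
Qed.

Lemma segment_counted (l : nat) : (0 < l)%N ->
  lattice_counted (segment l) (1 + l%:R *: 'X).
Proof.
move=> l_gt0 t t_gt0.
exists [seq const_mx i%:R | i <- iota 0 (t * l).+1]; split.
- rewrite map_inj_uniq ?iota_uniq // => i j /rowP /(_ 0); rewrite !mxE.
  by move=> /eqP; rewrite eqr_nat => /eqP.
- move=> x; split.
    move=> [/(segment_dilateP _ l_gt0 t_gt0) /andP [x0 xl] /(_ 0) xi].
    have /natrP [i xE] : x 0 0 \is a Num.nat by rewrite natrEint xi.
    apply/mapP; exists i; last by apply/rowP => j; rewrite mxE [j]ord1.
    by rewrite mem_iota /= add0n ltnS; move: xl; rewrite xE ler_nat.
  move=> /mapP [i]; rewrite mem_iota add0n ltnS /= => i_le ->; split.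
    by apply/segment_dilateP; rewrite // mxE ler0n ler_nat.
  by move=> j; rewrite mxE rpred_nat.
- rewrite size_map size_iota -addn1 natrD natrM hornerD hornerZ hornerX.
  by rewrite hornerC addrC mulrC.
Qed.

End Segment.

(** * Sign patterns of coefficients *)

Section Signs.
Context {R : realType}.

(** Each bound is attainable by the Archimedean property, as [v j] is nonzero. Successive choices
    are added up, which never lowers an earlier right-hand side. *)
Lemma dominating_nat (d : nat) (u v : nat -> R) :
  (forall j, (j < d)%N -> v j != 0) ->
  exists2 l : nat, (0 < l)%N & forall j, (j < d)%N -> `|u j| < l%:R * `|v j|.
Proof.
elim: d => [|d IHd] v_neq0; first by exists 1%N.
have [j jd|l l_gt0 lP] := IHd; first by apply: v_neq0; apply: ltnW.
exists (l + Num.bound (`|u d| / `|v d|))%N; first by rewrite addn_gt0 l_gt0.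
have vd_gt0 : 0 < `|v d| by rewrite normr_gt0 v_neq0.
move=> j; rewrite ltnS leq_eqVlt natrD mulrDl => /orP [/eqP ->|jd].
  apply: ltr_wpDl; first by rewrite mulr_ge0.
  by rewrite -ltr_pdivrMr // archi_boundP // divr_ge0.
by apply: ltr_wpDr; [rewrite mulr_ge0 | apply: lP].
Qed.

(** In the applications [d] is two below the degree of [a]; this leaves out the two top
    coefficients, as the theorem does. *)
Definition negative_then_positive (c d : nat) (a : {poly R}) : Prop :=
  (forall j, (j <= c)%N -> a`_j < 0) /\
  (forall j, (c < j <= d)%N -> 0 < a`_j).

Lemma negative_then_positive_neq0 c d a j :
  negative_then_positive c d a -> (j <= d)%N -> a`_j != 0.
Proof.
move=> [neg pos] jd; have [jc|cj] := leqP j c; first by rewrite lt_eqF ?neg.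
by rewrite gt_eqF // pos // cj.
Qed.

Lemma dominated_neg (u v : R) : `|u| < `|v| -> v < 0 -> u + v < 0.
Proof. by move=> + v0; rewrite (ltr0_norm v0) ltr_norml => /andP[]; lra. Qed.

Lemma dominated_pos (u v : R) : `|u| < `|v| -> 0 < v -> 0 < u + v.
Proof. by move=> + v0; rewrite (gtr0_norm v0) ltr_norml => /andP[]; lra. Qed.

(** In degree [j.+1] the sum has coefficient [u]_j.+1 + l * a[_j], whose second term decides the
    sign. Degree 0 is excluded because ['X * a] contributes nothing there. *)
Lemma negative_then_positive_shift c d (a u : {poly R}) (l : R) : 0 < l ->
  (c <= d)%N -> negative_then_positive c d a ->
  (forall j, (j <= d)%N -> `|u`_j.+1| < l * `|a`_j|) ->
  (forall j, (1 <= j <= c.+1)%N -> (u + l *: ('X * a))`_j < 0) /\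
  (forall j, (c.+1 < j <= d.+1)%N -> 0 < (u + l *: ('X * a))`_j).
Proof.
move=> l_gt0 cd [neg pos] dom.
split=> -[|j] //; rewrite coefD coefZ coefXM /=; rewrite !ltnS => j_range.
  apply: dominated_neg; last by rewrite pmulr_rlt0 // neg.
  by rewrite normrM gtr0_norm // dom // (leq_trans j_range).
apply: dominated_pos; last by rewrite pmulr_rgt0 // pos.
by rewrite normrM gtr0_norm // dom //; case/andP: j_range.
Qed.

(** The shift lemma with [u = a] settles the degrees from 1 on, and the constant term is that of
    [a], hence still negative: the negative run grows by one. *)
Lemma negative_then_positive_mul c d (a : {poly R}) : (c <= d)%N ->
  negative_then_positive c d a ->
  exists2 l : nat, (0 < l)%N &
    negative_then_positive c.+1 d.+1 ((1 + l%:R *: 'X) * a).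
Proof.
move=> cd a_sign.
have [j|l l_gt0 lP] := @dominating_nat d.+1 (fun j => a`_j.+1) (fun j => a`_j).
  by rewrite ltnS; apply: negative_then_positive_neq0 a_sign.
exists l => //; rewrite mulrDl mul1r -scalerAl.
have [||neg pos] := @negative_then_positive_shift c d a a l%:R _ cd a_sign.
- by rewrite ltr0n.
- by move=> j jd; apply: lP.
split=> // -[|j] j_range; last exact: neg.
by rewrite coefD coefZ coefXM mulr0 addr0; apply: (proj1 a_sign).
Qed.

Lemma coef_binomial (K j : nat) :
  ((1 + 'X) ^+ K : {poly R})`_j = 'C(K, j)%:R.
Proof.
elim: K j => [|K IHK] [|j]; rewrite ?expr0 ?coef1 //.
  by rewrite exprS mulrDl mul1r coefD coefXM IHK addr0 !bin0.
by rewrite exprS mulrDl mul1r coefD coefXM !IHK binS natrD.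
Qed.

(** The coefficient of degree j is s^2 C(K, j - 2) - C(K, j). The first term is absent for j = 0, 1
    and dominates for 2 <= j <= K once s is large. *)
Lemma negative_then_positive_base (K : nat) : (0 < K)%N ->
  exists2 s : nat, (0 < s)%N &
    negative_then_positive 1 K ((s%:R ^+ 2 *: 'X^2 - 1) * (1 + 'X) ^+ K).
Proof.
move=> K_gt0.
have [j|s s_gt0 sP] := @dominating_nat K.-1
    (fun j => 'C(K, j.+2)%:R) (fun j => 'C(K, j)%:R).
  by move=> jK; rewrite pnatr_eq0 -lt0n bin_gt0; lia.
exists s => //; split=> j.
  rewrite mulrBl mul1r -scalerAl coefB coefZ coefXnM !coef_binomial => j1.
  by rewrite ltnS j1 mulr0 sub0r oppr_lt0 ltr0n bin_gt0; lia.
case: j => [|[|j]] // jK.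
rewrite mulrBl mul1r -scalerAl coefB coefZ coefXnM !coef_binomial /= subn2 /=.
have jK' : (j < K.-1)%N by lia.
have := sP j jK'; rewrite !ger0_norm // => dom.
(* The bound was obtained with the factor s; it passes to s^2 because s >= 1. *)
rewrite subr_gt0 (lt_le_trans dom) // ler_wpM2r // -natrX ler_nat.
exact: leq_pmull.
Qed.

End Signs.

(** * The sum of fibre lengths over the grid *)

Section ReeveCount.

(** For [x] and [y] at most [t] this equals min(x, y) - max(0, x + y - t), and it is also the
    distance from (x, y) to the boundary of the square [0, t]^2. *)
Definition reeve_fibre (t x y : nat) : nat := minn (minn x y) (t - maxn x y).

Lemma sum_reeve_fibre (t : nat) :
  (6 * (\sum_(x < t.+1) \sum_(y < t.+1) reeve_fibre t x y) + t = t ^ 3)%N.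
Proof.
(* Removing the boundary of the grid lowers every remaining fibre by one, which
   links t to t + 2. *)
suff [] : (6 * (\sum_(x < t.+1) \sum_(y < t.+1) reeve_fibre t x y) + t = t ^ 3)%N
  /\ (6 * (\sum_(x < t.+2) \sum_(y < t.+2) reeve_fibre t.+1 x y) + t.+1
      = t.+1 ^ 3)%N by [].
elim: t => [|t [IH1 IH2]]; first by rewrite !big_ord_recl !big_ord0.
split=> //.
have ends (F : nat -> nat) : F 0%N = 0%N -> F t.+2 = 0%N ->
    (\sum_(x < t.+3) F x = \sum_(x < t.+1) F x.+1)%N.
  by move=> F0 Ft; rewrite big_ord_recl big_ord_recr /= F0 Ft addn0.
rewrite (ends (fun x => \sum_(y < t.+3) reeve_fibre t.+2 x y)%N); first last.
- by rewrite big1 // => y _; rewrite /reeve_fibre; lia.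
- by rewrite big1 // => y _; rewrite /reeve_fibre; lia.
rewrite (eq_bigr (fun x : 'I_t.+1 =>
    (t.+1 + \sum_(y < t.+1) reeve_fibre t x y)%N)); last first.
  move=> x _; rewrite ends; [|by rewrite /reeve_fibre; lia..].
  rewrite -[X in (X + _)%N]card_ord -[X in (X + _)%N]muln1.
  rewrite -sum_nat_const -big_split /=; apply: eq_bigr => y _.
  by rewrite /reeve_fibre; have := ltn_ord x; have := ltn_ord y; lia.
rewrite big_split /= sum_nat_const card_ord mulnDr -addnA; move: IH1.
set S := (\sum_(_ < _) _)%N; clear; move=> IH.
have -> : (t.+2 ^ 3 = 6 * (t.+1 * t.+1) + t ^ 3 + 2)%N by ring.
by rewrite -IH; ring.
Qed.

End ReeveCount.

(** * The Reeve tetrahedron: facets, lattice points and Ehrhart polynomial *)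

Section Reeve.
Context {R : realType}.

Definition vec3 (x y z : R) : 'rV[R]_3 := \row_j [:: x; y; z]`_j.

Lemma vec3_eta (v : 'rV[R]_3) : v = vec3 (v 0 0) (v 0 1) (v 0 2%:R).
Proof.
by apply/rowP => -[[|[|[|//]]] i]; rewrite mxE; congr (v 0 _); apply: val_inj.
Qed.

Lemma vec3_inj x y z x' y' z' :
  vec3 x y z = vec3 x' y' z' -> [/\ x = x', y = y' & z = z'].
Proof.
move=> /rowP v_eq; have := (v_eq 0, v_eq 1, v_eq 2%:R).
by rewrite !mxE => -[[]].
Qed.

Lemma integer_points_vec3 x y z : integer_points (vec3 x y z) <->
  [/\ x \is a Num.int, y \is a Num.int & z \is a Num.int].
Proof.
split=> [v_int|[xi yi zi] [[|[|[|//]]] i]]; rewrite ?mxE //.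
by have := (v_int 0, v_int 1, v_int 2%:R); rewrite !mxE => -[[]].
Qed.

Definition reeve_vertex (h : nat) (i : 'I_4) : 'rV[R]_3 :=
  [:: vec3 0 0 0; vec3 1 0 0; vec3 0 1 0; vec3 1 1 h%:R]`_i.

Definition reeve (h : nat) : set 'rV[R]_3 := convex_hull (reeve_vertex h).

Lemma reeve_comb (h : nat) (a0 a1 a2 a3 : R) :
  \sum_(i < 4) [:: a0; a1; a2; a3]`_i *: reeve_vertex h i =
  vec3 (a1 + a3) (a2 + a3) (a3 * h%:R).
Proof.
rewrite !big_ord_recl big_ord0 /reeve_vertex /=.
by apply/rowP => -[[|[|[|//]]] i]; rewrite !mxE /=; ring.
Qed.

(** Explicit barycentric coordinates of an arbitrary point. Multiplied by [h], they become the
    linear forms that define the four facets. *)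
Lemma reeve_weights (h : nat) (x y z : R) : (0 < h)%N ->
  exists a0 a1 a2 a3 : R,
    [/\ \sum_(i < 4) [:: a0; a1; a2; a3]`_i = 1,
        vec3 x y z = \sum_(i < 4) [:: a0; a1; a2; a3]`_i *: reeve_vertex h i &
        [/\ h%:R * a0 = h%:R - h%:R * (x + y) + z, h%:R * a1 = h%:R * x - z,
            h%:R * a2 = h%:R * y - z & h%:R * a3 = z]].
Proof.
move=> h_gt0; have h_neq0 : h%:R != 0 :> R by rewrite pnatr_eq0 -lt0n.
exists (1 - x - y + z / h%:R), (x - z / h%:R), (y - z / h%:R), (z / h%:R).
rewrite reeve_comb !big_ord_recl big_ord0 /= !subrK divfK //.
by split=> //; [ring | split; field].
Qed.

(** Each inequality is the nonnegativity of [h] times one barycentric coordinate. *)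
Lemma reeveP (h : nat) (x y z : R) : (0 < h)%N ->
  reeve h (vec3 x y z) <->
  [/\ 0 <= z, z <= h%:R * x, z <= h%:R * y & h%:R * (x + y) <= h%:R + z].
Proof.
move=> h_gt0; have h_gt0' : 0 < h%:R :> R by rewrite ltr0n.
split.
  move=> [a [a_ge0 a_sum]].
  (* The abstract weights are rewritten as a list of four entries so that [reeve_comb] applies. *)
  pose a' k := a (inord k).
  have aE (i : 'I_4) : a i = [:: a' 0%N; a' 1%N; a' 2%N; a' 3%N]`_i.
    case: i => [[|[|[|[|//]]]] i]; congr (a _); apply: val_inj;
    by rewrite /= inordK.
  rewrite (eq_bigr (fun i : 'I_4 => [:: a' 0%N; a' 1%N; a' 2%N; a' 3%N]`_i
    *: reeve_vertex h i)); last by move=> i _; rewrite aE.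
  rewrite reeve_comb => /vec3_inj [-> -> ->].
  move: a_sum; rewrite (eq_bigr _ (fun i _ => aE i)) !big_ord_recl big_ord0 /=.
  have a'_ge0 k : 0 <= a' k by apply: a_ge0.
  have := (a'_ge0 0%N, a'_ge0 1%N, a'_ge0 2%N, a'_ge0 3%N).
  by move=> [[[? ?] ?] ?] ?; split; nra.
move=> [z0 zx zy xyz].
have [a0 [a1 [a2 [a3 [a_sum aE [e0 e1 e2 e3]]]]]] := reeve_weights x y z h_gt0.
eexists; split; [|exact: a_sum | exact: aE].
by case=> [[|[|[|[|//]]]] i] /=; rewrite -(pmulr_rge0 _ h_gt0'); lra.
Qed.

Lemma reeve_full (h : nat) : (0 < h)%N -> full_lattice_polytope (reeve h).
Proof.
move=> h_gt0; exists 4, (reeve_vertex h); split=> //.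
  by case=> [[|[|[|[|//]]]] i]; apply/integer_points_vec3; rewrite ?rpred_nat.
move=> v; rewrite (vec3_eta v).
have [a0 [a1 [a2 [a3 [a_sum aE _]]]]] :=
  reeve_weights (v 0 0) (v 0 1) (v 0 2%:R) h_gt0.
by eexists; split; [exact: a_sum | exact: aE].
Qed.

Lemma reeve_dilateP (h t : nat) (x y z : R) : (0 < h)%N -> (0 < t)%N ->
  dilate t (reeve h) (vec3 x y z) <->
  [/\ 0 <= z, z <= h%:R * x, z <= h%:R * y
    & h%:R * (x + y) <= h%:R * t%:R + z].
Proof.
move=> h_gt0 t_gt0; have t_gt0' : 0 < t%:R :> R by rewrite ltr0n.
have scaleE (a x' y' z' : R) :
    a *: vec3 x' y' z' = vec3 (a * x') (a * y') (a * z').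
  by apply/rowP => -[[|[|[|//]]] i]; rewrite !mxE.
have -> : dilate t (reeve h) (vec3 x y z) <->
    reeve h (vec3 (x / t%:R) (y / t%:R) (z / t%:R)).
  rewrite ![_ / _]mulrC -scaleE; split=> [[v vP <-]|vP].
    by rewrite scalerA mulVf ?gt_eqF // scale1r.
  by eexists; first exact: vP; rewrite scalerA divff ?gt_eqF // scale1r.
rewrite reeveP // -(ler_pM2l t_gt0') -[z / _ <= h%:R * (x / _)](ler_pM2l t_gt0').
rewrite -[z / _ <= h%:R * (y / _)](ler_pM2l t_gt0').
rewrite -[h%:R * _ <= _](ler_pM2l t_gt0').
have -> : t%:R * (z / t%:R) = z by rewrite mulrC divfK // gt_eqF.
have tE : t%:R != 0 :> R by rewrite gt_eqF.
have -> : t%:R * (h%:R * (x / t%:R)) = h%:R * x by field.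
have -> : t%:R * (h%:R * (y / t%:R)) = h%:R * y by field.
have -> : t%:R * (h%:R * (x / t%:R + y / t%:R)) = h%:R * (x + y) by field.
have -> : t%:R * (h%:R + z / t%:R) = h%:R * t%:R + z by field.
by rewrite mulr0.
Qed.

Definition grid (t : nat) : seq (nat * nat) :=
  [seq (x, y) | x <- index_iota 0 t.+1, y <- index_iota 0 t.+1].

(* After scaling heights by h, the t-th dilate of the tetrahedron lies above the
   grid point (x, y) between max(0, x + y - t) and min(x, y). *)
Definition reeve_heights (h t : nat) (p : nat * nat) : seq nat :=
  iota (h * (p.1 + p.2 - t)) (h * reeve_fibre t p.1 p.2).+1.

(** Truncated subtraction makes [x + y - t] the maximum of 0 and x + y - t, and adding the fibre
    length to it gives [minn x y], the upper end. *)
Lemma mem_reeve_heights (h t x y z : nat) : (0 < h)%N ->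
  ((x, y) \in grid t) && (z \in reeve_heights h t (x, y)) =
  [&& z <= h * x, z <= h * y & h * (x + y) <= h * t + z]%N.
Proof.
move=> h_gt0; rewrite mem_iota /= addnS ltnS -mulnDr.
have -> : ((x, y) \in grid t) = (x <= t)%N && (y <= t)%N.
  apply/allpairsP/andP => [[[x' y'] [/= + + [-> ->]]]|[xt yt]].
    by rewrite !mem_index_iota !ltnS.
  by exists (x, y); rewrite !mem_index_iota !ltnS.
apply/idP/idP.
  move=> /andP [/andP [xt yt] /andP [z_ge z_le]].
  have minE : (x + y - t + reeve_fibre t x y = minn x y)%N.
    by rewrite /reeve_fibre; lia.
  rewrite minE in z_le.
  rewrite !(leq_trans z_le) ?leq_mul2l ?geq_minl ?geq_minr ?orbT //=.
  apply: leq_trans (leq_add (leqnn _) z_ge).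
  by rewrite -mulnDr leq_mul2l -leq_subLR leqnn orbT.
move=> /and3P [zx zy xyz].
(* The inequalities already confine (x, y) to the grid: h (x + y) <= h t + z and z <= h x give y <=
   t, and symmetrically for x. *)
have yt : (y <= t)%N.
  rewrite -(leq_pmul2l h_gt0) -(leq_add2l (h * x)) -mulnDr.
  by rewrite (leq_trans xyz) // addnC leq_add2r.
have xt : (x <= t)%N.
  rewrite -(leq_pmul2l h_gt0) -(leq_add2r (h * y)) -mulnDr.
  by rewrite (leq_trans xyz) // leq_add2l.
have -> : (x + y - t + reeve_fibre t x y = minn x y)%N.
  by rewrite /reeve_fibre; lia.
rewrite xt yt mulnBr leq_subLR xyz /=.
by rewrite /minn; case: ifP.
Qed.

(** Each of the (t + 1)^2 grid points carries 1 + h f lattice points, f being its fibre length. The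
    fibre lengths sum to (t^3 - t) / 6, and the factor 6 in the height cancels this denominator. *)
Lemma reeve_counted (M : nat) : (0 < M)%N ->
  lattice_counted (reeve (6 * M))
    (('X + 1) ^+ 2 + M%:R *: ('X ^+ 3 - 'X)).
Proof.
move=> M_gt0 t t_gt0; set h := (6 * M)%N.
have h_gt0 : (0 < h)%N by rewrite muln_gt0.
exists [seq vec3 p.1%:R p.2%:R z%:R | p <- grid t, z <- reeve_heights h t p].
split.
- apply: allpairs_uniq_dep.
  + by apply: allpairs_uniq; rewrite ?iota_uniq // => -[? ?] [? ?].
  + by move=> p _; apply: iota_uniq.
  + move=> [[x y] z] [[x' y'] z'] _ _ /= /vec3_inj [].
    move=> /eqP + /eqP + /eqP; rewrite !eqr_nat.
    by move=> /eqP -> /eqP -> /eqP ->.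
- move=> v; split.
    rewrite (vec3_eta v); move: (v 0 0) (v 0 1) (v 0 2%:R) => x y z.
    move=> [/(reeve_dilateP _ _ _ h_gt0 t_gt0) [z0 zx zy xyz]].
    move=> /integer_points_vec3 [xi yi zi].
    have h_gt0' : 0 < h%:R :> R by rewrite ltr0n.
    have nat_of_int (u : R) : u \is a Num.int -> 0 <= u ->
        exists k : nat, u = k%:R.
      by move=> ui u0; apply/natrP; rewrite natrEint ui.
    have [a xE] : exists a : nat, x = a%:R.
      by apply: nat_of_int; rewrite // -(pmulr_rge0 _ h_gt0') (le_trans z0).
    have [b yE] : exists b : nat, y = b%:R.
      by apply: nat_of_int; rewrite // -(pmulr_rge0 _ h_gt0') (le_trans z0).
    have [c zE] := nat_of_int _ zi z0.
    move: zx zy xyz; rewrite xE yE zE -natrD -!natrM -natrD !ler_nat.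
    move=> zx zy xyz.
    have := mem_reeve_heights t a b c h_gt0.
    rewrite zx zy xyz => /andP [ab_in c_in].
    by apply/allpairsPdep; exists (a, b), c.
  move=> /allpairsPdep [[a b] [c [ab_in c_in ->]]].
  have := mem_reeve_heights t a b c h_gt0; rewrite ab_in c_in.
  move=> /esym/and3P [zx zy xyz]; split; last first.
    by apply/integer_points_vec3; rewrite !rpred_nat.
  by apply/reeve_dilateP => //=; rewrite -natrD -!natrM -natrD !ler_nat.
- rewrite size_allpairs_dep sumnE big_map big_allpairs /= big_mkord.
  rewrite (eq_bigr (fun x : 'I_t.+1 =>
      (t.+1 + h * \sum_(y < t.+1) reeve_fibre t x y)%N)); last first.
    move=> x _; rewrite big_mkord big_distrr /=.
    rewrite -[X in (X + _)%N]card_ord -[X in (X + _)%N]muln1.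
    rewrite -sum_nat_const -big_split /=; apply: eq_bigr => y _.
    by rewrite size_iota add1n.
  rewrite big_split /= sum_nat_const card_ord -big_distrr /=.
  have := sum_reeve_fibre t; set S := (\sum_(_ < _) _)%N => SE.
  have {SE} SE : 6%:R * S%:R + t%:R = t%:R ^+ 3 :> R.
    by rewrite -natrX -SE natrD natrM.
  rewrite !hornerE -SE /h !(natrD, natrM) -[t.+1%:R]natr1.
  by ring.
Qed.

End Reeve.

(** * Boxes whose Ehrhart polynomials yield the sign pattern *)

Section Boxes.
Context {R : realType}.

Lemma unit_box (K : nat) :
  exists P : set 'rV[R]_K.+1,
    full_lattice_polytope P /\ lattice_counted P ((1 + 'X) ^+ K.+1).
Proof.
have seg1 : lattice_counted (segment 1 : set 'rV[R]_1) (1 + 'X).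
  by have := segment_counted (R := R) (ltnSn 0); rewrite scale1r.
elim: K => [|K [P [P_full P_counted]]].
  by exists (segment 1); split; [apply: segment_full | rewrite expr1].
exists (polytope_prod (segment 1) P : set 'rV[R]_(1 + K.+1)); split.
  exact: full_lattice_polytope_prod (segment_full (ltnSn 0)) P_full.
by rewrite exprS; exact: lattice_counted_prod seg1 P_counted.
Qed.

(** Induction on [n] from a unit cube. The scale [s] is fixed by the cube; each further segment
    length is chosen afterwards and moves the sign change up by one degree. *)
Lemma box_sign_pattern (n K : nat) :
  exists (s : nat) (P : set 'rV[R]_(n + K.+1)) (p : {poly R}),
    [/\ (0 < s)%N, full_lattice_polytope P, lattice_counted P p &
        negative_then_positive n.+1 (n + K.+1) ((s%:R ^+ 2 *: 'X^2 - 1) * p)].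
Proof.
elim: n => [|n [s [P [p [s_gt0 P_full P_counted sign]]]]].
  have [P [P_full P_counted]] := unit_box K.
  have [s s_gt0 sign] := @negative_then_positive_base R K.+1 isT.
  by exists s, P, ((1 + 'X) ^+ K.+1).
have [|l l_gt0 l_sign] := negative_then_positive_mul _ sign.
  by rewrite addnS ltnS leq_addr.
exists s, (polytope_prod (segment l) P : set 'rV[R]_(1 + (n + K.+1))).
exists ((1 + l%:R *: 'X) * p); split=> //.
- exact: full_lattice_polytope_prod (segment_full l_gt0) P_full.
- exact: lattice_counted_prod (segment_counted l_gt0) P_counted.
- by rewrite mulrCA.
Qed.

End Boxes.

(** * Choice of the height and assembly of the product *)

Unset Implicit Arguments.
Set Strict Implicit.

Theorem theorem4p4 (R : realType) (n k : nat) (hn : (1 <= n)%N) (hk : (4 <= k)%N) :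
  exists (N : nat) (P : set 'rV[R]_N),
    [/\ integral_polytope P,
        has_dimension P (n + k) &
        exists p : {poly R},
          [/\ ehrhart_polynomial P p,
              forall i : nat, (n + 3 <= i <= n + k - 2)%N -> 0 < p`_i &
              forall i : nat, (1 <= i <= n + 2)%N -> p`_i < 0]].
Proof.
(* Since [4 <= k], the value [k - 4] makes the box of dimension [d = n + k - 3], so that the
   tetrahedron brings the total to [n + k]. *)
have [s [B [h [s_gt0 B_full B_counted sign]]]] :=
  box_sign_pattern (R := R) n (k - 4).
set a := _ * h in sign; set d := (n + (k - 4).+1)%N in B B_full B_counted sign.
(* The part of the final polynomial free of [M]; [M] is chosen last, to dominate it. *)
pose u : {poly R} := (('X + 1) ^+ 2 \Po (s%:R *: 'X)) * h.
have s_gt0' : 0 < s%:R :> R by rewrite ltr0n.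
have [j jd|M M_gt0 M_dom] := @dominating_nat R d.+1 (fun j => u`_j.+1)
    (fun j => s%:R * a`_j).
  apply: mulf_neq0; first by rewrite gt_eqF.
  exact: negative_then_positive_neq0 sign jd.
(* Dilation by [s] turns t^3 - t into s t (s^2 t^2 - 1), the source of the quadratic factor in
   [a]. *)
pose Q : set 'rV[R]_3 := dilate s (reeve (6 * M)).
have h_gt0 : (0 < 6 * M)%N by rewrite muln_gt0.
have P_full : full_lattice_polytope (polytope_prod Q B).
  apply: full_lattice_polytope_prod => //.
  by apply: full_lattice_polytope_dilate => //; apply: reeve_full.
have P_counted := lattice_counted_prod
  (lattice_counted_dilate s_gt0 (reeve_counted M_gt0)) B_counted.
exists (3 + d)%N, (polytope_prod Q B); split.
- exact: full_lattice_polytope_integral.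
- have -> : (n + k = 3 + d)%N by rewrite /d; lia.
  exact: full_lattice_polytope_dim.
have pE : ((('X + 1) ^+ 2 + M%:R *: ('X ^+ 3 - 'X)) \Po (s%:R *: 'X)) * h
    = u + (M%:R * s%:R) *: ('X * a).
  rewrite /u /a -!mul_polyC !(rmorphD, rmorphN, rmorphM, rmorphXn) /=.
  rewrite !comp_polyX !comp_polyC.
  ring.
rewrite pE in P_counted.
(* The factor ['X] moves the sign change of [a] up by one: negative in degrees 1 to n + 2, then
   positive up to d + 1 = n + k - 2. *)
have [|||neg pos] :=
    @negative_then_positive_shift R n.+1 d a u (M%:R * s%:R) _ _ sign.
- by rewrite mulr_gt0 // ltr0n.
- by rewrite /d addnS ltnS leq_addr.
- move=> j jd; apply: lt_le_trans (M_dom j jd) _.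
  by rewrite normrM gtr0_norm // mulrA.
exists (u + (M%:R * s%:R) *: ('X * a)); split.
- exact: lattice_counted_ehrhart P_counted.
- by move=> i i_range; apply: pos; lia.
- by move=> i i_range; apply: neg; lia.
Qed.
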